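(* Let $\Gamma$ be a distance-regular graph of order $v$, with valency $k>2$ and diameter $d\ge2$, with a full indubitable partition corresponding to an eigenvalue $\lambda$ of $\Gamma$ with multiplicity $m$. Then one of the following holds: $\Gamma$ is bipartite and $\lambda=-k$; or $\Gamma$ is a complete $(m+1)$-partite graph and $\lambda=-v/(m+1)$; or $\Gamma$ is a distance-regular antipodal cover of a complete graph $K_{m+1}$ and $\lambda=-1$ (with $d=3$).
   Context: Graphs are finite, simple and undirected; eigenvalues of $\Gamma$ are those of its $01$-adjacency matrix. A connected graph $\Gamma$ of diameter $d$ is distance-regular if its distance-$i$ graphs $\Gamma_i$ ($1\le i\le d$; two vertices adjacent in $\Gamma_i$ iff at distance $i$ in $\Gamma$) form an association scheme, i.e. the span of $I$ and their adjacency matrices is closed under matrix multiplication. A distance-regular graph of diameter $d$ is antipodal if $\Gamma_d$ is a disjoint union of cliques (so that being equal or at distance $d$ is an equivalence relation). A distance-regular antipodal cover of $K_{m+1}$ is an antipodal distance-regular graph of diameter $3$ with $m+1$ antipodal classes, in which the edges between any two distinct antipodal classes form a perfect matching between them. A partition $\Pi$ of the vertex set of a connected graph $\Gamma$ (into nonempty cells) is indubitable with parameters $(a,b)$ if for each cell $\mathcal{P}\in\Pi$ and each vertex $x$, the number of neighbors of $x$ in $\mathcal{P}$ equals $a$ if $x\in\mathcal{P}$, and equals $b$ otherwise. An indubitable partition with $r+1\ge2$ cells corresponds to the eigenvalue $\lambda=a-b$ of $\Gamma$; it is full (corresponding to $\lambda$) if $r$ equals the multiplicity $m$ of $\lambda$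 as an eigenvalue of $\Gamma$. *)

(* Defs.v *)
From mathcomp Require Import all_boot all_order all_algebra.

Set Implicit Arguments.
Unset Strict Implicit.
Unset Printing Implicit Defensive.

Import GRing.Theory.
Local Open Scope ring_scope.

(* A finite simple undirected graph is a symmetric irreflexive relation e on a
   finite type T of vertices; both properties are hypotheses where needed. *)

Section Graphs.
Variables (T : finType) (e : rel T).

Definition connected : Prop := forall x y : T, connect e x y.

Definition nbhd (x : T) : {set T} := [set y | e x y].

Definition regular (k : nat) : Prop := forall x : T, #|nbhd x| = k.

Definition walk (n : nat) (x y : T) : bool :=
  [exists p : n.-tuple T, path e x p && (last x p == y)].

(* Least length of a walk from x to y. A shortest walk has fewer than #|T|
   edges, so the search range suffices; the value is #|T| if there is none. *)
Definition gdist (x y : T) : nat :=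
  find (fun n => walk n x y) (iota 0 #|T|).

Definition diameter : nat := (\max_(x : T) \max_(y : T) gdist x y)%N.

Definition dist_graph (i : nat) : rel T := fun x y => gdist x y == i.

Definition bipartite : Prop :=
  exists A : {set T}, forall x y, e x y -> (x \in A) != (y \in A).

Definition complete_multipartite (n : nat) : Prop :=
  exists P : {set {set T}},
    [/\ partition P [set: T], #|P| = n
      & forall x y, e x y = (pblock P x != pblock P y)].

Definition cliques_of (P : {set {set T}}) (f : rel T) : Prop :=
  partition P [set: T] /\
  forall x y, f x y = (x != y) && (pblock P x == pblock P y).

Definition perfect_matching_between (B C : {set T}) : Prop :=
  (forall x, x \in B -> #|nbhd x :&: C| = 1%N) /\
  (forall y, y \in C -> #|nbhd y :&: B| = 1%N).

Definition indubitable (a b : nat) (P : {set {set T}}) : Prop :=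
  partition P [set: T] /\
  forall (C : {set T}) (x : T), C \in P ->
    #|nbhd x :&: C| = if x \in C then a else b.

End Graphs.

Section Spectrum.
Variable R : rcfType.

(* The vertices are numbered by the canonical enumeration of T. *)
Definition adjmx (T : finType) (f : rel T) : 'M[R]_#|T| :=
  \matrix_(i, j) (f (enum_val i) (enum_val j))%:R.

Variables (T : finType) (e : rel T).

Definition graph_eigenvalue (lambda : R) : bool :=
  eigenvalue (adjmx e) lambda.

Definition multiplicity (lambda : R) : nat :=
  \rank (eigenspace (adjmx e) lambda).

Definition distance_matrices : seq 'M[R]_#|T| :=
  1%:M :: [seq adjmx (dist_graph e i) | i <- iota 1 (diameter e)].

Definition distance_regular : Prop :=
  connected e /\
  forall M N : 'M[R]_#|T|,
    M \in <<distance_matrices>>%VS -> N \in <<distance_matrices>>%VS ->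
    M *m N \in <<distance_matrices>>%VS.

Definition full_indubitable (P : {set {set T}}) (lambda : R) : Prop :=
  exists a b : nat,
    [/\ indubitable e a b P, (2 <= #|P|)%N, lambda = a%:R - b%:R
      & #|P| = (multiplicity lambda).+1].

Definition antipodal_cover_of_complete (n : nat) : Prop :=
  [/\ distance_regular, diameter e = 3%N
    & exists P : {set {set T}},
        [/\ cliques_of P (dist_graph e (diameter e)), #|P| = n
          & forall B C, B \in P -> C \in P -> B != C ->
              perfect_matching_between e B C]].

End Spectrum.

Arguments distance_regular R {T} e.
Arguments antipodal_cover_of_complete R {T} e n.

(* Main.v *)
Require Import Defs.
From mathcomp Require Import all_boot all_order all_algebra.

Set Implicit Arguments.
Unset Strict Implicit.
Unset Printing Implicit Defensive.

Import GRing.Theory Num.Theory.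

(** The orthogonal projector E onto the lambda-eigenspace is a polynomial in the
adjacency matrix, so it lies in the Bose-Mesner algebra and E_xy depends only on
d(x, y). Since E_xx is constant, E_xy = E_xx holds exactly when the rows x and y
of E coincide, that is, when every lambda-eigenvector takes the same value at x
and y. For a full indubitable partition the eigenvectors are constant on the
cells and separate them, so whether x and y share a cell is a function of
d(x, y).

Adjacent vertices then lie in distinct cells, by connectedness, so a = 0 and
lambda = - b. Two cells make the graph bipartite. If there are more and vertices
at distance 2 share a cell, then no distance exceeds 2 and the graph is complete
multipartite. Otherwise two neighbours of a vertex never share a cell, so b = 1,
and vertices at distance 3 share a cell; looking at the neighbours of the middle
vertex of a geodesic of length 4 shows that there is no such geodesic. *)

Lemma exists_notin (T : finType) (A B : {pred T}) :
  #|B| < #|A| -> exists2 x, x \in A & x \notin B.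
Proof.
move=> ltBA; apply/subsetPn; apply: contraL ltBA => /subset_leq_card.
by rewrite -leqNgt.
Qed.

Lemma leq_cards2 (T : finType) (x y : T) : #|[set x; y]| <= 2.
Proof. by rewrite cards2; case: eqP. Qed.

(** * Distances in a connected graph *)

Section Distance.
Variables (T : finType) (e : rel T).
Hypothesis e_conn : connected e.

Lemma walkP n x y :
  reflect (exists p, [/\ size p = n, path e x p & last x p = y])
          (walk e n x y).
Proof.
apply: (iffP existsP) => [[p /andP[path_p /eqP last_p]]|[p [<- path_p last_p]]].
  by exists p; rewrite size_tuple.
by exists (in_tuple p); rewrite /= path_p last_p eqxx.
Qed.

Lemma gdist_lt_card x y : gdist e x y < #|T|.
Proof.
rewrite /gdist -[X in _ < X](size_iota 0) -has_find.
have /connectP[p path_p ->] := e_conn x y.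
case/shortenP: path_p => q path_q uniq_q _; apply/hasP; exists (size q).
  rewrite mem_iota -[(size q).+1]/(size (x :: q)).
  by rewrite -(card_uniqP uniq_q) max_card.
by apply/walkP; exists q.
Qed.

Lemma gdist_path x p : path e x p -> gdist e x (last x p) <= size p.
Proof.
move=> path_p; rewrite leqNgt; apply/negP => lt_pd.
have := before_find 0 lt_pd; rewrite nth_iota ?add0n; last first.
  exact: ltn_trans lt_pd (gdist_lt_card _ _).
by move/walkP; apply; exists p.
Qed.

Lemma shortest_pathP x y :
  exists p, [/\ size p = gdist e x y, path e x p & last x p = y].
Proof.
apply/walkP; have lt_d := gdist_lt_card x y.
have has_walk : has (fun n => walk e n x y) (iota 0 #|T|).
  by rewrite has_find size_iota.
by have := nth_find 0 has_walk; rewrite -/(gdist e x y) nth_iota.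
Qed.

Lemma gdistxx x : gdist e x x = 0.
Proof. by apply/eqP; rewrite -leqn0 (@gdist_path x [::]). Qed.

Lemma gdist_eq0 x y : (gdist e x y == 0) = (x == y).
Proof.
apply/eqP/eqP => [d0|->]; last exact: gdistxx.
by have [p [+ _ <-]] := shortest_pathP x y; rewrite d0 => /size0nil->.
Qed.

Lemma gdist_triangle y x z : gdist e x z <= gdist e x y + gdist e y z.
Proof.
have [p [<- path_p last_p]] := shortest_pathP x y.
have [q [<- path_q <-]] := shortest_pathP y z.
by rewrite -last_p -last_cat -size_cat gdist_path // cat_path path_p last_p.
Qed.

Lemma gdist1P x y : irreflexive e -> reflect (gdist e x y = 1) (e x y).
Proof.
move=> e_irr; apply: (iffP idP) => [exy|d1].
  apply/eqP; rewrite eqn_leq (@gdist_path x [:: y]) /= ?exy // lt0n gdist_eq0.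
  by apply: contraTneq exy => ->; rewrite e_irr.
have [p []] := shortest_pathP x y; rewrite d1.
by case: p => [|z [|? ?]] //= _; rewrite andbT => + <-.
Qed.

Lemma gdist_sym x y : symmetric e -> gdist e x y = gdist e y x.
Proof.
move=> e_sym; suffices le_d u v : gdist e u v <= gdist e v u.
  by apply/eqP; rewrite eqn_leq !le_d.
have [p [<- path_p <-]] := shortest_pathP v u.
have {2}-> : v = last (last v p) (rev (belast v p)).
  by case: p {path_p} => //= w p; rewrite rev_cons last_rcons.
rewrite -(size_belast v p) -size_rev gdist_path // rev_path.
by rewrite (eq_path (e' := e)).
Qed.

Lemma gdist_add_eq i j x y z :
  gdist e x z = i + j -> gdist e x y <= i -> gdist e y z <= j ->
  gdist e x y = i /\ gdist e y z = j.
Proof.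
move=> dxz le_i le_j; have := gdist_triangle y x z; rewrite dxz => le_ij.
split; apply/eqP; rewrite eqn_leq ?le_i ?le_j /=.
  by rewrite -(leq_add2r j) (leq_trans le_ij) ?leq_add2l.
by rewrite -(leq_add2l i) (leq_trans le_ij) ?leq_add2r.
Qed.

Lemma gdist_split i j x z : gdist e x z = i + j ->
  exists y, gdist e x y = i /\ gdist e y z = j.
Proof.
move=> dxz; have [p [size_p]] := shortest_pathP x z; rewrite dxz in size_p.
rewrite -(cat_take_drop i p) cat_path last_cat => /andP[path_p path_q last_q].
exists (last x (take i p)); apply: gdist_add_eq => //.
  by rewrite (leq_trans (gdist_path path_p)) // size_takel // size_p leq_addr.
by rewrite -last_q (leq_trans (gdist_path path_q)) // size_drop size_p addKn.
Qed.

Lemma gdist_le_diameter x y : gdist e x y <= diameter e.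
Proof.
by apply: leq_trans (leq_bigmax x); apply: (leq_bigmax (F := gdist e x)).
Qed.

Lemma diameter_le n : (forall x y, gdist e x y <= n) -> diameter e <= n.
Proof. by move=> le_n; apply/bigmax_leqP=> x _; apply/bigmax_leqP. Qed.

Lemma exists_gdist n : 0 < n <= diameter e -> exists x y, gdist e x y = n.
Proof.
case: n => //= n lt_nd; case: (boolP [exists x, exists y, n < gdist e x y]).
  case/existsP=> x /existsP[y lt_n].
  by have [z [dxz _]] := gdist_split (esym (subnKC lt_n)); exists x, z.
move/existsPn=> le_n; suff : diameter e <= n by rewrite leqNgt lt_nd.
by apply: diameter_le => x y; rewrite leqNgt; have /existsPn := le_n x.
Qed.

End Distance.

Definition gdist_determined (T : finType) (e : rel T) (r : T -> T -> Prop)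
    : Prop :=
  forall x y x' y', gdist e x y = gdist e x' y' -> r x y -> r x' y'.

(** * Partitions whose cells are determined by the distance *)

Section Cells.
Variables (T : finType) (P : {set {set T}}).
Hypothesis partP : partition P [set: T].

Lemma mem_pblock_self x : x \in pblock P x.
Proof. by rewrite mem_pblock (cover_partition partP). Qed.

Lemma pblock_cell x : pblock P x \in P.
Proof. by rewrite pblock_mem // (cover_partition partP). Qed.

Lemma mem_cell x C : C \in P -> (x \in C) = (pblock P x == C).
Proof.
have /and3P[_ tiP _] := partP => PC.
by apply/idP/eqP => [|<-]; [exact: def_pblock | exact: mem_pblock_self].
Qed.

Lemma cell_pblock C : C \in P -> exists x, pblock P x = C.
Proof.
move=> PC; have /and3P[_ _ P0] := partP.
have /set0Pn[x Cx] : C != set0 by apply: contraNneq P0 => <-.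
by exists x; apply/eqP; rewrite -mem_cell.
Qed.

Lemma card_partition_setI (A : {set T}) : #|A| = \sum_(C in P) #|A :&: C|.
Proof.
rewrite -sum1_card.
rewrite (eq_bigl (fun x => (x \in [set: T]) && (x \in A))) => [|x]; last first.
  by rewrite inE.
rewrite (set_partition_big_cond _ partP); apply: eq_bigr => C _.
by rewrite sum1dep_card setIC; apply: eq_card => x; rewrite !inE.
Qed.

End Cells.

Section Indubitable.
Variables (T : finType) (e : rel T) (P : {set {set T}}) (a b : nat).
Hypothesis P_ind : indubitable e a b P.
Let partP : partition P [set: T] := P_ind.1.

Lemma card_nbhd_cell x C : C \in P ->
  #|nbhd e x :&: C| = if pblock P x == C then a else b.
Proof. by move=> PC; rewrite P_ind.2 // (mem_cell partP). Qed.

Lemma card_nbhd_indubitable x : #|nbhd e x| = a + #|P|.-1 * b.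
Proof.
have Px := pblock_cell partP x.
rewrite (card_partition_setI partP) (big_setD1 _ Px) card_nbhd_cell // eqxx /=.
rewrite (cardsD1 (pblock P x) P) Px -sum_nat_const; congr (_ + _).
apply: eq_bigr => C.
by rewrite !inE eq_sym => /andP[/negPf neqC PC]; rewrite card_nbhd_cell ?neqC.
Qed.

Lemma nbr_in_cell x C : 0 < b -> C \in P -> pblock P x != C ->
  exists2 y, e x y & pblock P y = C.
Proof.
move=> b_gt0 PC neqC; have := card_nbhd_cell x PC; rewrite (negPf neqC) => bE.
have /card_gt0P[y] : 0 < #|nbhd e x :&: C| by rewrite bE.
by rewrite !inE (mem_cell partP) // => /andP[exy /eqP]; exists y.
Qed.

Lemma indubitable_perfect_matching B C :
  b = 1 -> B \in P -> C \in P -> B != C -> perfect_matching_between e B C.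
Proof.
move=> b1 PB PC neqBC; split=> x; rewrite (mem_cell partP) // => /eqP xE.
  by rewrite card_nbhd_cell // xE (negPf neqBC).
by rewrite card_nbhd_cell // xE eq_sym (negPf neqBC).
Qed.

End Indubitable.

Section DistanceCells.
Variables (T : finType) (e : rel T) (P : {set {set T}}) (a b k : nat).
Hypotheses (e_sym : symmetric e) (e_irr : irreflexive e).
Hypothesis e_conn : connected e.
Hypotheses (e_val : regular e k) (k_gt2 : 2 < k).
Hypothesis P_ind : indubitable e a b P.
Hypothesis P_gt1 : 1 < #|P|.
Hypothesis cells_gdist :
  gdist_determined e (fun x y => pblock P x = pblock P y).
Let partP : partition P [set: T] := P_ind.1.
Local Notation d := (gdist e).
Local Notation edgeP := (gdist1P e_conn _ _ e_irr).

Lemma edge_cells_neq x y : e x y -> pblock P x != pblock P y.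
Proof.
move=> exy; apply/eqP=> same_xy.
have same u v : pblock P u = pblock P v.
  have /connectP[p + ->] := e_conn u v.
  elim: p u => //= w p IHp u /andP[euw /IHp<-].
  by apply: cells_gdist same_xy; rewrite !(edgeP _).
have /card_gt1P[C [D [PC PD]]] := P_gt1.
have [[u <-] [w <-]] := (cell_pblock partP PC, cell_pblock partP PD).
by rewrite (same u w) eqxx.
Qed.

Lemma inner_degree0 : a = 0.
Proof.
have /card_gt0P[C /(cell_pblock partP)[x _]] := ltnW P_gt1.
have Px := pblock_cell partP x.
have := card_nbhd_cell P_ind x Px; rewrite eqxx => <-.
apply: eq_card0 => y; rewrite !inE (mem_cell partP) //.
by apply/negP=> /andP[/edge_cells_neq]; rewrite eq_sym => /negPf->.
Qed.

Lemma valency_cells : k = #|P|.-1 * b.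
Proof.
have /card_gt0P[C /(cell_pblock partP)[x _]] := ltnW P_gt1.
by rewrite -(e_val x) (card_nbhd_indubitable P_ind) inner_degree0.
Qed.

Lemma outer_degree_gt0 : 0 < b.
Proof.
by move: k_gt2; rewrite valency_cells; case: (b) => //; rewrite muln0.
Qed.

Lemma gdist_le2 y x z : e x y -> e y z -> d x z <= 2.
Proof.
by move=> exy eyz; rewrite (@gdist_path _ _ e_conn x [:: y; z]) //= exy eyz.
Qed.

Lemma gdist_le2_cases x y : d x y <= 2 -> [\/ x = y, e x y | d x y = 2].
Proof.
case dxy: (d x y) => [|[|[|//]]] _; last exact: Or33.
  by apply: Or31; apply/eqP; rewrite -(gdist_eq0 e_conn) dxy.
by apply: Or32; apply/edgeP.
Qed.

Lemma bipartite_of_two_cells : #|P| = 2 -> bipartite e /\ k = b.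
Proof.
move=> P2; split; last by rewrite valency_cells P2 mul1n.
have /card_gt1P[C [D [PC PD neqCD]]] := P_gt1; exists C => x y /edge_cells_neq.
have PE : P = [set C; D].
  apply/esym/eqP; rewrite eqEcard P2 cards2 neqCD andbT.
  by apply/subsetP=> B /set2P[]->.
have neqDC : D != C by rewrite eq_sym.
have C_or_D z : (pblock P z == C) || (pblock P z == D).
  by rewrite -in_set2 -PE pblock_cell.
rewrite !(mem_cell partP) //; case/orP: (C_or_D x) => /eqP->;
  by case/orP: (C_or_D y) => /eqP->; rewrite ?eqxx ?(negPf neqDC).
Qed.

Section Distance2Same.
Hypothesis same2 : forall x y, d x y = 2 -> pblock P x = pblock P y.

Lemma edge_of_gdist_le2 x y : d x y <= 2 -> pblock P x != pblock P y -> e x y.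
Proof. by case/gdist_le2_cases=> [->|//|/same2->]; rewrite eqxx. Qed.

Lemma edge_trans y x z : e x y -> e y z -> pblock P x != pblock P z -> e x z.
Proof. by move=> exy eyz; apply/edge_of_gdist_le2/(gdist_le2 exy eyz). Qed.

Lemma gdist_le2_of_three_cells x z : 2 < #|P| -> d x z <= 2.
Proof.
move=> P_gt2; rewrite leqNgt; apply/negP=> d_gt2.
have {d_gt2 z} [z [dxz _]] := gdist_split e_conn (esym (subnKC d_gt2)).
have [y [/edgeP exy dyz]] := gdist_split e_conn (dxz : _ = 1 + 2).
have [t [/edgeP eyt /edgeP etz]] := gdist_split e_conn (dyz : _ = 1 + 1).
have [dxt _] := gdist_add_eq e_conn (dxz : _ = 2 + 1)
  (gdist_le2 exy eyt) (eq_leq (edgeP etz)).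
have [C PC] :=
  exists_notin (leq_ltn_trans (leq_cards2 (pblock P x) (pblock P y)) P_gt2).
rewrite !inE negb_or => /andP[neqCx neqCy].
have [w etw wC] : exists2 w, e t w & pblock P w = C.
  apply: (nbr_in_cell P_ind outer_degree_gt0) => //.
  by rewrite -(same2 dxt) eq_sym.
have ewt : e w t by rewrite e_sym.
have ewy : e w y by apply: (edge_trans ewt); rewrite 1?e_sym ?wC.
have ewz : e w z by apply: (edge_trans ewt); rewrite // wC -(same2 dyz).
have exw : e x w by apply: (edge_trans exy); rewrite 1?e_sym // wC eq_sym.
by have := gdist_le2 exw ewz; rewrite dxz.
Qed.

Lemma complete_multipartite_of_gdist_le2 :
  (forall x y, d x y <= 2) ->
  complete_multipartite e #|P| /\ #|T| = #|P| * b.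
Proof.
move=> d_le2; have eE x y : e x y = (pblock P x != pblock P y).
  by apply/idP/idP => [/edge_cells_neq|/edge_of_gdist_le2->].
split; first by exists P.
rewrite -cardsT; apply: card_uniform_partition partP => C PC.
have [D PD] : exists2 D, D \in P & D \notin [set C].
  by apply: exists_notin; rewrite cards1.
have [x <-] := cell_pblock partP PD; rewrite inE => neq_xC.
have := card_nbhd_cell P_ind x PC; rewrite (negPf neq_xC) => <-.
apply/esym/eq_card=> y; rewrite !inE eE (mem_cell partP) //.
by case: (pblock P y =P C) => [->|]; rewrite ?neq_xC ?andbF.
Qed.

End Distance2Same.

Section Distance2Different.
Hypothesis diff2 : forall x y, d x y = 2 -> pblock P x != pblock P y.
Hypothesis diam_ge2 : 2 <= diameter e.
Hypothesis common_nbhd_gdist : forall x y x' y', d x y = d x' y' ->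
  #|nbhd e x :&: nbhd e y| = #|nbhd e x' :&: nbhd e y'|.

Lemma same_cell_gdist_gt2 x y : pblock P x = pblock P y -> x != y -> 2 < d x y.
Proof.
move=> same_xy neq_xy; rewrite ltnNge; apply/negP.
case/gdist_le2_cases=> [xyE|/edge_cells_neq|/diff2]; rewrite ?same_xy ?eqxx //.
by rewrite xyE eqxx in neq_xy.
Qed.

Lemma nbr_cell_inj x y z :
  e x y -> e x z -> pblock P y = pblock P z -> y = z.
Proof.
move=> exy exz same_yz; apply/eqP; apply: contraT.
move/(same_cell_gdist_gt2 same_yz).
by rewrite ltnNge (gdist_le2 _ exz) // e_sym.
Qed.

Lemma outer_degree1 : b = 1.
Proof.
have [x [y dxy]] := exists_gdist e_conn (diam_ge2 : 0 < 2 <= _).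
apply/eqP; rewrite eqn_leq outer_degree_gt0 andbT.
have := card_nbhd_cell P_ind x (pblock_cell partP y).
rewrite (negPf (diff2 dxy)) => <-; apply/card_le1_eqP => u w.
rewrite !inE !(mem_cell partP) ?pblock_cell //.
move=> /andP[exu /eqP uy] /andP[exw /eqP wy].
by apply: nbr_cell_inj exw exu _; rewrite uy.
Qed.

Lemma exists_gdist3_same_cell :
  exists x y, d x y = 3 /\ pblock P x = pblock P y.
Proof.
have [x [y dxy]] := exists_gdist e_conn (diam_ge2 : 0 < 2 <= _).
have [z exz same_zy] :=
  nbr_in_cell P_ind outer_degree_gt0 (pblock_cell partP y) (diff2 dxy).
exists z, y; split=> //; apply/eqP.
rewrite eqn_leq same_cell_gdist_gt2 ?andbT //.
  apply: leq_trans (gdist_triangle e_conn x z y) _.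
  by rewrite dxy (edgeP _) // e_sym.
by apply/eqP=> zyE; rewrite zyE in exz; rewrite (edgeP exz) in dxy.
Qed.

Lemma gdist3_same_cell x y : d x y = 3 -> pblock P x = pblock P y.
Proof.
have [u [w [duw same_uw]]] := exists_gdist3_same_cell => dxy.
by apply: cells_gdist same_uw; rewrite duw dxy.
Qed.

Lemma geodesic4_mid_nbr x0 x1 x2 x3 x4 y :
  d x0 x4 = 4 -> path e x0 [:: x1; x2; x3; x4] ->
  e x2 y -> y != x1 -> y != x3 -> e y x1.
Proof.
move=> d04 /and5P[e01 e12 e23 e34 _] e2y neq_y1 neq_y3.
have le_path := gdist_path e_conn.
have split_geodesic := gdist_add_eq e_conn.
have [_ d14] : d x0 x1 = 1 /\ d x1 x4 = 3.
  apply: (split_geodesic 1 3 _ _ _ d04); first by rewrite (edgeP e01).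
  by rewrite (le_path x1 [:: x2; x3; x4]) //= e12 e23 e34.
have [d03 _] : d x0 x3 = 3 /\ d x3 x4 = 1.
  apply: (split_geodesic 3 1 _ _ _ d04); last by rewrite (edgeP e34).
  by rewrite (le_path x0 [:: x1; x2; x3]) //= e01 e12 e23.
have le_0y : d x0 y <= 2.
  have : d x0 y <= 3 by rewrite (le_path x0 [:: x1; x2; y]) //= e01 e12 e2y.
  rewrite leq_eqVlt => /predU1P[/gdist3_same_cell same_0y|//].
  case/eqP: neq_y3; apply: (nbr_cell_inj e2y e23).
  by rewrite -same_0y (gdist3_same_cell d03).
have le_y4 : d y x4 <= 2.
  have : d y x4 <= 3.
    by rewrite (le_path y [:: x2; x3; x4]) //= e_sym e2y e23 e34.
  rewrite leq_eqVlt => /predU1P[/gdist3_same_cell same_y4|//].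
  case/eqP: neq_y1; apply: (nbr_cell_inj e2y); rewrite 1?e_sym //.
  by rewrite same_y4 (gdist3_same_cell d14).
have [d0y dy4] := split_geodesic 2 2 _ _ _ d04 le_0y le_y4.
have [z [/edgeP e0z /edgeP ezy]] := gdist_split e_conn (d0y : _ = 1 + 1).
have [_ dz4] : d x0 z = 1 /\ d z x4 = 3.
  apply: (split_geodesic 1 3 _ _ _ d04); first by rewrite (edgeP e0z).
  by rewrite (leq_trans (gdist_triangle e_conn y _ _)) // (edgeP ezy) dy4.
have <- : z = x1; last by rewrite e_sym.
apply: (nbr_cell_inj e0z e01).
by rewrite (gdist3_same_cell dz4) (gdist3_same_cell d14).
Qed.

(* On a geodesic x0 x1 x2 x3 x4 a third neighbour of x2 is adjacent to x1 and
   x3, so vertices at distance 2 have at least two common neighbours; but a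
   second common neighbour of x0 and x2 would then be adjacent to x3. *)
Lemma gdist_neq4 x0 x4 : d x0 x4 != 4.
Proof.
apply/eqP=> d04.
have [x1 [/edgeP e01 d14]] := gdist_split e_conn (d04 : _ = 1 + 3).
have [x2 [/edgeP e12 d24]] := gdist_split e_conn (d14 : _ = 1 + 2).
have [x3 [/edgeP e23 /edgeP e34]] := gdist_split e_conn (d24 : _ = 1 + 1).
have [e10 e21 e32 e43] : [/\ e x1 x0, e x2 x1, e x3 x2 & e x4 x3].
  by rewrite !(e_sym _ x0) (e_sym x2) (e_sym x3) (e_sym x4).
have d40 : d x4 x0 = 4 by rewrite gdist_sym.
have geod04 : path e x0 [:: x1; x2; x3; x4] by rewrite /= e01 e12 e23 e34.
have geod40 : path e x4 [:: x3; x2; x1; x0] by rewrite /= e43 e32 e21 e10.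
have [d02 _] := gdist_add_eq e_conn (d04 : _ = 2 + 2)
  (gdist_le2 e01 e12) (eq_leq d24).
have [d13 _] := gdist_add_eq e_conn (d14 : _ = 2 + 1)
  (gdist_le2 e12 e23) (eq_leq (edgeP e34)).
have [y] : exists2 y, y \in nbhd e x2 & y \notin [set x1; x3].
  by apply: exists_notin; rewrite e_val (leq_ltn_trans (leq_cards2 _ _)).
rewrite !inE negb_or => e2y /andP[neq_y1 neq_y3].
have ey1 := geodesic4_mid_nbr d04 geod04 e2y neq_y1 neq_y3.
have ey3 := geodesic4_mid_nbr d40 geod40 e2y neq_y3 neq_y1.
have c2_gt1 : 1 < #|nbhd e x0 :&: nbhd e x2|.
  rewrite (common_nbhd_gdist (etrans d02 (esym d13))).
  apply/card_gt1P; exists x2, y.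
  rewrite !inE e12 e32 !(e_sym _ y) ey1 ey3; split=> //.
  by apply: contraTneq e2y => <-; rewrite e_irr.
have [z] : exists2 z, z \in nbhd e x0 :&: nbhd e x2 & z \notin [set x1].
  by apply: exists_notin; rewrite cards1.
rewrite !inE => /andP[e0z e2z] neq_z1.
have d03_gt2 : 2 < d x0 x3.
  by have := gdist_triangle e_conn x3 x0 x4; rewrite d04 (edgeP e34) addn1.
have neq_z3 : z != x3 by apply: contraTneq d03_gt2 => <-; rewrite (edgeP e0z).
have ez3 := geodesic4_mid_nbr d40 geod40 e2z neq_z3 neq_z1.
by have := gdist_le2 e0z ez3; rewrite leqNgt d03_gt2.
Qed.

Lemma diameter3 : diameter e = 3.
Proof.
have [x [y [dxy _]]] := exists_gdist3_same_cell.
apply/eqP; rewrite eqn_leq -{2}dxy gdist_le_diameter andbT.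
apply: diameter_le => u w; rewrite leqNgt; apply/negP=> d_gt3.
have [z [duz _]] := gdist_split e_conn (esym (subnKC d_gt3)).
by have := gdist_neq4 u z; rewrite duz.
Qed.

Lemma cliques_of_antipodal_graph : cliques_of P (dist_graph e (diameter e)).
Proof.
split=> // x y; rewrite diameter3 /dist_graph.
apply/eqP/andP => [dxy|[neq_xy /eqP same_xy]].
  by rewrite (gdist3_same_cell dxy) eqxx -(gdist_eq0 e_conn) dxy.
apply/eqP; rewrite eqn_leq same_cell_gdist_gt2 // andbT -diameter3.
exact: gdist_le_diameter.
Qed.

End Distance2Different.

Lemma distance_cells_trichotomy :
  2 <= diameter e ->
  (forall x y x' y', d x y = d x' y' ->
     #|nbhd e x :&: nbhd e y| = #|nbhd e x' :&: nbhd e y'|) ->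
  [\/ bipartite e /\ k = b,
      complete_multipartite e #|P| /\ #|T| = #|P| * b
    | [/\ cliques_of P (dist_graph e (diameter e)), diameter e = 3 & b = 1]].
Proof.
move=> diam_ge2 common_nbhd_gdist.
have [P_le2|P_gt2] := leqP #|P| 2.
  apply: Or31; apply: bipartite_of_two_cells.
  by apply/eqP; rewrite eqn_leq P_le2.
have [x [y dxy]] := exists_gdist e_conn (diam_ge2 : 0 < 2 <= _).
have [same_xy|diff_xy] := eqVneq (pblock P x) (pblock P y).
  have same2 u w : d u w = 2 -> pblock P u = pblock P w.
    by move=> duw; apply: cells_gdist same_xy; rewrite dxy duw.
  apply: Or32; apply: complete_multipartite_of_gdist_le2 => // u w.
  exact: gdist_le2_of_three_cells.
have diff2 u w : d u w = 2 -> pblock P u != pblock P w.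
  move=> duw; apply: contra_neq diff_xy.
  by apply: cells_gdist; rewrite dxy duw.
apply: Or33; split; first exact: cliques_of_antipodal_graph.
  exact: diameter3.
exact: outer_degree1.
Qed.

End DistanceCells.

Local Open Scope ring_scope.

(** * Orthogonal projectors onto eigenspaces *)

Lemma mulmx_tr_eq0 (R : realDomainType) m n (B : 'M[R]_(m, n)) :
  B *m B^T = 0 -> B = 0.
Proof.
move=> BB0; apply/matrixP=> i j; rewrite mxE.
have /eqP : (B *m B^T) i i = 0 by rewrite BB0 mxE.
rewrite mxE psumr_eq0 => [|l _]; last by rewrite mxE -expr2 sqr_ge0.
by move/allP/(_ j (mem_index_enum _)); rewrite /= mxE -expr2 sqrf_eq0 => /eqP.
Qed.

Lemma sym_nilpotent_eq0 (R : realDomainType) n (B : 'M[R]_n.+1) k :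
  B^T = B -> B ^+ k.+1 = 0 -> B = 0.
Proof.
move=> symB; have symX i : (B ^+ i)^T = B ^+ i.
  elim: i => [|i IHi]; first by rewrite expr0 trmx1.
  by rewrite {1}exprS trmx_mul IHi symB -[_ *m _]exprSr.
elim: k => [|k IHk]; first by rewrite expr1.
move=> Bk0; apply/IHk/mulmx_tr_eq0.
by rewrite symX -[_ *m _]exprD addSnnS exprD Bk0 mulr0.
Qed.

Lemma trmx_horner_mx (R : comNzRingType) n (A : 'M[R]_n.+1) p :
  (horner_mx A p)^T = horner_mx A^T p.
Proof.
elim/poly_ind: p => [|p c IHp]; first by rewrite !rmorph0 trmx0.
rewrite [in LHS]commr_polyX !rmorphD !rmorphM /= !horner_mx_X !horner_mx_C.
by rewrite linearD /= trmx_mul IHp tr_scalar_mx.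
Qed.

Lemma mulmx_horner_mx (R : comNzRingType) m n (A : 'M[R]_n.+1)
    (U : 'M[R]_(m, n.+1)) a p :
  U *m A = a *: U -> U *m horner_mx A p = p.[a] *: U.
Proof.
move=> UA; elim/poly_ind: p => [|p c IHp].
  by rewrite rmorph0 horner0 mulmx0 scale0r.
rewrite rmorphD rmorphM /= horner_mx_X horner_mx_C mulmxDr mulmxA IHp.
by rewrite -scalemxAl UA mul_mx_scalar hornerMXaddC scalerA scalerDl.
Qed.

Lemma memv_horner_mx (F : fieldType) n (A : 'M[F]_n.+1)
    (S : {vspace 'M[F]_n.+1}) p :
  1%:M \in S -> A \in S ->
  (forall M N, M \in S -> N \in S -> M *m N \in S) -> horner_mx A p \in S.
Proof.
move=> S1 SA SM; elim/poly_ind: p => [|p c IHp]; first by rewrite rmorph0 mem0v.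
rewrite rmorphD rmorphM /= horner_mx_X horner_mx_C memvD ?SM //.
by rewrite -scalemx1 memvZ.
Qed.

(* Write the characteristic polynomial as q * ('X - a) ^+ l with q.[a] != 0.
   The symmetric matrix q(A) (A - a) is nilpotent, hence zero, so q(A) / q.[a]
   is the projector. *)
Lemma sym_eigenprojector (R : realFieldType) n (A : 'M[R]_n.+1) a :
  A^T = A ->
  exists p, let E := horner_mx A p in
    E *m E = E /\ (E :=: eigenspace A a)%MS.
Proof.
move=> symA; have [l [q qa]] := multiplicity_XsubC (char_poly A) a.
rewrite monic_neq0 ?char_poly_monic //= in qa => charE.
have kill_q : horner_mx A (q * ('X - a%:P)) = 0.
  apply: (@sym_nilpotent_eq0 _ _ _ l); first by rewrite trmx_horner_mx symA.
  rewrite -rmorphXn exprMn exprS exprSr mulrACA -charE rmorphM /=.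
  by rewrite Cayley_Hamilton mul0r.
exists (q.[a]^-1 *: q); set E := horner_mx A _.
have EA : E *m A = a *: E.
  apply/eqP; rewrite -subr_eq0 -mul_mx_scalar -mulmxBr.
  rewrite -[A in A - _]horner_mx_X -(horner_mx_C A) -rmorphB.
  by rewrite -[_ *m _]rmorphM /= -scalerAl linearZ /= kill_q scaler0.
have E_fix m (U : 'M_(m, _)) : U *m A = a *: U -> U *m E = U.
  by move=> UA; rewrite (mulmx_horner_mx _ UA) hornerZ mulVf ?scale1r.
split; first exact: E_fix.
apply/eqmxP/andP; split; first exact/eigenspaceP.
by rewrite -{1}(E_fix _ (eigenspace A a)) ?submxMl //; apply/eigenspaceP.
Qed.

Lemma eigenprojector_in_vspace (R : realFieldType) n (A : 'M[R]_n)
    (S : {vspace 'M[R]_n}) a :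
  1%:M \in S -> A \in S ->
  (forall M N, M \in S -> N \in S -> M *m N \in S) -> A^T = A ->
  exists E, [/\ E \in S, E *m E = E & (E :=: eigenspace A a)%MS].
Proof.
case: n A S => [|n] A S S1 SA SM symA.
  by exists 0; rewrite mem0v mul0mx [eigenspace _ _]thinmx0.
have [p [EE defE]] := sym_eigenprojector a symA.
by exists (horner_mx A p); split=> //; apply: memv_horner_mx.
Qed.

Lemma sym_idempotent_row_eq (R : realDomainType) n (E : 'M[R]_n) i j :
  E^T = E -> E *m E = E -> E i i = E j j -> E i j = E i i -> row i E = row j E.
Proof.
move=> symE EE eq_diag Eij.
apply/eqP; rewrite -subr_eq0; apply/eqP/mulmx_tr_eq0.
have dot x y : (row x E) *m (row y E)^T = (E x y)%:M.
  rewrite tr_row symE -row_mul; apply/matrixP=> s t.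
  by rewrite !ord1 !mxE -[in RHS]EE mxE; apply: eq_bigr => l _; rewrite !mxE.
have Eji : E j i = E i i by rewrite -Eij -[in RHS]symE mxE.
rewrite linearB /= mulmxBl !mulmxBr !dot Eji -eq_diag Eij.
by rewrite !subrr.
Qed.

Definition eigenvectors_agree (F : fieldType) n (A : 'M[F]_n) a
    (i j : 'I_n) : Prop :=
  forall u : 'rV_n, (u <= eigenspace A a)%MS -> u 0 i = u 0 j.

Lemma eigenvectors_agree_projector (R : realFieldType) n (A E : 'M[R]_n) a i j :
  E^T = E -> E *m E = E -> (E :=: eigenspace A a)%MS -> E i i = E j j ->
  eigenvectors_agree A a i j <-> E i j = E i i.
Proof.
move=> symE EE defE eq_diag.
split=> [agree|/(sym_idempotent_row_eq symE EE eq_diag) rowE u].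
  have := agree (row i E); rewrite -defE row_sub !mxE => /(_ isT); exact: esym.
rewrite -defE => /submxP[D ->]; rewrite !mxE; apply: eq_bigr => l _.
have /rowP/(_ l) := rowE; rewrite !mxE => E_il.
by rewrite -symE !mxE E_il.
Qed.

(** * The Bose-Mesner algebra *)

Lemma sum_indicator (R : pzSemiRingType) (T : finType) (B C : {set T}) :
  \sum_(x in B) (x \in C)%:R = #|B :&: C|%:R :> R.
Proof.
rewrite -sum1_card natr_sum big_mkcond [RHS]big_mkcond; apply: eq_bigr => x _.
by rewrite inE; do 2!case: (_ \in _).
Qed.

Section BoseMesner.
Variables (R : rcfType) (T : finType) (e : rel T).
Hypotheses (e_sym : symmetric e) (e_irr : irreflexive e).
Local Notation A := (adjmx R e).
Local Notation S := <<distance_matrices R e>>%VS.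

Lemma mulmx_adjmx m (M : 'M[R]_(m, #|T|)) i y :
  (M *m A) i (enum_rank y) = \sum_(x in nbhd e y) M i (enum_rank x).
Proof.
rewrite mxE (reindex_onto enum_rank enum_val) => [|j _]; last exact: enum_valK.
rewrite [RHS]big_mkcond /=.
apply: eq_big => [x|x _]; first by rewrite enum_rankK eqxx.
by rewrite mxE !enum_rankK inE e_sym; case: e; rewrite ?mulr1 ?mulr0.
Qed.

Section DistanceRegular.
Hypothesis e_dr : distance_regular R e.
Let e_conn : connected e := e_dr.1.

Lemma distance_span_gdist M x y x' y' :
  M \in S -> gdist e x y = gdist e x' y' ->
  M (enum_rank x) (enum_rank y) = M (enum_rank x') (enum_rank y').
Proof.
move=> /(coord_span (X := in_tuple _))-> eq_d.
rewrite !summxE; apply: eq_bigr => i _; rewrite !mxE; congr (_ * _).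
have /= := mem_nth 0 (ltn_ord i); rewrite inE => /orP[/eqP->|/mapP[j _ ->]].
  by rewrite !mxE !(inj_eq enum_rank_inj) -!(gdist_eq0 e_conn) eq_d.
by rewrite !mxE !enum_rankK /dist_graph eq_d.
Qed.

Lemma distance_span_sym M : M \in S -> M^T = M.
Proof.
move=> SM; apply/matrixP => i j; rewrite mxE -(enum_valK i) -(enum_valK j).
by apply: distance_span_gdist; rewrite // gdist_sym.
Qed.

Lemma scalar1_distance_span : 1%:M \in S.
Proof. by rewrite memv_span // mem_head. Qed.

Lemma adjmx_distance_span : A \in S.
Proof.
have edgeP x y := gdist1P e_conn x y e_irr.
have [d0|d_gt0] := posnP (diameter e).
  suff -> : A = 0 by rewrite mem0v.
  apply/matrixP=> i j; rewrite !mxE; case: edgeP => // dij.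
  by have := gdist_le_diameter e (enum_val i) (enum_val j); rewrite d0 dij.
have -> : A = adjmx R (dist_graph e 1).
  by apply/matrixP=> i j; rewrite !mxE /dist_graph (sameP eqP (edgeP _ _)).
by rewrite memv_span // inE map_f ?orbT // mem_iota add1n ltnS.
Qed.

Lemma card_common_nbhd_gdist x y x' y' : gdist e x y = gdist e x' y' ->
  #|nbhd e x :&: nbhd e y| = #|nbhd e x' :&: nbhd e y'|.
Proof.
move=> eq_d; have SA := adjmx_distance_span.
have AA u v :
    (A *m A) (enum_rank u) (enum_rank v) = #|nbhd e v :&: nbhd e u|%:R.
  rewrite mulmx_adjmx -sum_indicator; apply: eq_bigr => z _.
  by rewrite mxE !enum_rankK inE.
rewrite (setIC (nbhd e x)) (setIC (nbhd e x')).
apply/eqP; rewrite -(eqr_nat R) -!AA; apply/eqP.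
by apply: distance_span_gdist eq_d; apply: e_dr.2.
Qed.

Lemma eigenvectors_agree_gdist lambda :
  gdist_determined e
    (fun x y => eigenvectors_agree A lambda (enum_rank x) (enum_rank y)).
Proof.
have SA := adjmx_distance_span.
have [E [SE EE defE]] := eigenprojector_in_vspace lambda
  scalar1_distance_span SA e_dr.2 (distance_span_sym SA).
have E_gdist := distance_span_gdist SE.
have diagE x y : E (enum_rank x) (enum_rank x) = E (enum_rank y) (enum_rank y).
  by apply: E_gdist; rewrite !gdistxx.
have agreeE x y :=
  eigenvectors_agree_projector (distance_span_sym SE) EE defE (diagE x y).
move=> x y x' y' eq_d /agreeE Exy; apply/agreeE.
by rewrite -(E_gdist _ _ _ _ eq_d) Exy (diagE x x').
Qed.

End DistanceRegular.

Section CellMatrix.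
Variables (P : {set {set T}}) (a b : nat).
Hypothesis P_ind : indubitable e a b P.
Let partP : partition P [set: T] := P_ind.1.
Let lambda : R := a%:R - b%:R.

Definition cell_mx : 'M[R]_(#|P|, #|T|) :=
  \matrix_(i < #|P|, j < #|T|) (enum_val j \in enum_val i)%:R.

Lemma cell_mxE i x : cell_mx i (enum_rank x) = (pblock P x == enum_val i)%:R.
Proof. by rewrite mxE enum_rankK (mem_cell partP) // enum_valP. Qed.

Lemma mulmx_cell_mx (u : 'rV_#|P|) i x :
  pblock P x = enum_val i -> (u *m cell_mx) 0 (enum_rank x) = u 0 i.
Proof.
move=> xi; rewrite mxE (bigD1 i) //= cell_mxE xi eqxx mulr1 big1 ?addr0 // => j.
by rewrite cell_mxE xi (inj_eq enum_val_inj) eq_sym => /negPf->; rewrite mulr0.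
Qed.

Lemma cell_mx_row_free : row_free cell_mx.
Proof.
apply: inj_row_free => u u0; apply/rowP=> i.
have [x xi] := cell_pblock partP (enum_valP i).
by rewrite -(mulmx_cell_mx u xi) u0 !mxE.
Qed.

Lemma cell_mx_mul_adjmx : cell_mx *m A = lambda *: cell_mx + const_mx b%:R.
Proof.
apply/matrixP=> i j; rewrite -(enum_valK j); set y := enum_val j.
have PC := enum_valP i; rewrite mulmx_adjmx 2!mxE cell_mxE mxE.
under eq_bigr do rewrite cell_mxE -(mem_cell partP) //.
rewrite sum_indicator (card_nbhd_cell P_ind) // /lambda.
by case: ifP => _; rewrite ?mulr1 ?mulr0 ?add0r ?subrK.
Qed.

Lemma cell_mx_sub_row_eigenspace i j :
  (row i cell_mx - row j cell_mx <= eigenspace A lambda)%MS.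
Proof.
apply/eigenspaceP; rewrite mulmxBl -!row_mul cell_mx_mul_adjmx !linearD /=.
by rewrite !linearZ !row_const addrACA subrr addr0.
Qed.

Hypothesis P_full : #|P| = (multiplicity e lambda).+1.

(* The cell indicators span a space of dimension m + 1 which A - lambda sends
   onto a line, so its intersection with the eigenspace has dimension m. *)
Lemma eigenspace_sub_cell_mx : (eigenspace A lambda <= cell_mx)%MS.
Proof.
set B := A - lambda%:M; set K := cell_mx.
have rank_KB : (\rank (K *m B) <= 1)%N.
  have -> : K *m B = (const_mx b%:R : 'cV_#|P|) *m (const_mx 1 : 'rV_#|T|).
    rewrite mulmxBr cell_mx_mul_adjmx mul_mx_scalar addrC addKr.
    by apply/matrixP=> i j; rewrite !mxE big_ord1 !mxE mulr1.
  exact: mulmx_max_rank.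
have rank_K :
    (\rank (K *m B) + \rank (K :&: kermx B)%MS)%N = (\rank (kermx B)).+1.
  by rewrite mxrank_mul_ker (eqP cell_mx_row_free) P_full.
have le_rank : (\rank (kermx B) <= \rank (K :&: kermx B)%MS)%N.
  by rewrite -ltnS -rank_K -add1n leq_add2r.
apply: submx_trans (capmxSl K (kermx B)).
by rewrite -(geq_leqif (mxrank_leqif_sup (capmxSr K (kermx B)))).
Qed.

Lemma eigenvectors_agree_cells x y :
  eigenvectors_agree A lambda (enum_rank x) (enum_rank y) <->
  pblock P x = pblock P y.
Proof.
pose cell_rank z := enum_rank_in (pblock_cell partP x) (pblock P z).
have cell_rankK z : enum_val (cell_rank z) = pblock P z.
  by rewrite enum_rankK_in // pblock_cell.
split=> [agree|same_xy u].
  have := agree _ (cell_mx_sub_row_eigenspace (cell_rank x) (cell_rank y)).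
  rewrite !(mxE, cell_mxE) !cell_rankK !eqxx eq_sym; case: eqP => // _ /eqP.
  by rewrite subr0 sub0r -subr_eq0 opprK -(natrD _ 1 1) pnatr_eq0.
move/submx_trans/(_ eigenspace_sub_cell_mx)/submxP=> [D ->].
by rewrite !(mulmx_cell_mx _ (i := cell_rank x)) ?cell_rankK.
Qed.

End CellMatrix.

Lemma full_indubitable_cells_gdist (lambda : R) (P : {set {set T}}) :
  distance_regular R e -> full_indubitable e P lambda ->
  gdist_determined e (fun x y => pblock P x = pblock P y).
Proof.
move=> e_dr [a [b [P_ind _ -> P_full]]] x y x' y' eq_d.
have agreeE := eigenvectors_agree_cells P_ind P_full.
move/agreeE=> agree; apply/agreeE.
exact: (eigenvectors_agree_gdist e_dr eq_d agree).
Qed.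

End BoseMesner.

Theorem proposition4p2 (R : rcfType) (T : finType) (e : rel T)
    (v k d m : nat) (lambda : R) (P : {set {set T}})
    (e_sym : symmetric e) (e_irr : irreflexive e)
    (e_dr : distance_regular R e)
    (e_order : #|T| = v)
    (e_val : regular e k) (k_gt2 : (2 < k)%N)
    (e_diam : diameter e = d) (d_ge2 : (2 <= d)%N)
    (lambda_eig : graph_eigenvalue e lambda)
    (lambda_mult : multiplicity e lambda = m)
    (P_full : full_indubitable e P lambda) :
  [\/ bipartite e /\ lambda = - k%:R,
      complete_multipartite e m.+1 /\ lambda = - (v%:R / m.+1%:R)
    | [/\ antipodal_cover_of_complete R e m.+1, lambda = -1 & d = 3%N]].
Proof.
have e_conn := e_dr.1; have [a [b [P_ind P_gt1 lambda_ab P_card]]] := P_full.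
have cells_gdist := full_indubitable_cells_gdist e_sym e_irr e_dr P_full.
have a0 := inner_degree0 e_irr e_conn P_ind P_gt1 cells_gdist.
have {a0 lambda_ab} lambda_b : lambda = - b%:R by rewrite lambda_ab a0 sub0r.
have {P_card} Pm : #|P| = m.+1 by rewrite P_card lambda_mult.
rewrite -e_diam in d_ge2 *; rewrite -Pm -e_order.
have [[e_bip ->]|[e_cm ->]|[cliquesP d3 b1]] := distance_cells_trichotomy
  e_sym e_irr e_conn e_val k_gt2 P_ind P_gt1 cells_gdist d_ge2
  (card_common_nbhd_gdist e_sym e_irr e_dr).
- exact: Or31.
- apply: Or32; split=> //.
  by rewrite natrM mulrAC divff ?mul1r // Pm pnatr_eq0.
- apply: Or33; split=> //; last by rewrite lambda_b b1.
  split=> //; exists P; split=> // B C.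
  exact: (indubitable_perfect_matching P_ind).
Qed.
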